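(* Let $P$ be a finite bicolored poset with $n$ elements and set of celeste elements $C$, let $\omega : P \to [n]$ be a reverse natural labeling of $P$, and let $\tau : P \to [n]$ be a natural labeling of $P$. Then \[ \Omega^{\circ}_{P,C}(x,y) \;=\; \sum_{L} \Omega^{\circ}_{\omega_L}(x,y) \qquad\text{and}\qquad \Omega_{P,C}(x,y) \;=\; \sum_{L} \Omega_{\tau_L}(x,y), \] where both sums are over all linear extensions $L$ of $P$ and $x,y$ are nonnegative integers.
   Context: $[x]=\{1,\dots,x\}$. A bicolored poset is a finite poset $(P,\preceq)$ written as a disjoint union of two subsets $C$ (celeste elements) and $S$ (silver elements). An order preserving $(x,y)$-map is a map $\varphi : P \to [x]$ such that $a \preceq b$ implies $\varphi(a) \le \varphi(b)$ for all $a,b \in P$, and $\varphi(c) \ge y$ for all $c \in C$. A strictly order preserving $(x,y)$-map is a map $\varphi : P \to [x]$ such that $a \prec b$ implies $\varphi(a) < \varphi(b)$ for all $a,b\in P$, and $\varphi(c) > y$ for all $c \in C$. $\Omega_{P,C}(x,y)$ and $\Omega^{\circ}_{P,C}(x,y)$ are the numbers of order preserving $(x,y)$-maps and of strictly order preserving $(x,y)$-maps, respectively. A labeling of $P$ is a bijection $\omega: P \to [n]$; it is natural if $a \prec b$ implies $\omega(a)<\omega(b)$, and reverse natural if $a\prec b$ implies $\omega(a)>\omega(b)$. A linear extension of $P$ is a chain $L = \{a_1 \prec a_2 \prec \cdots \prec a_n\}$ on the same underlying set (with the same celeste/silver partition) such that $a \preceq_P b$ implies $a \preceq_L b$. For a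 labeling $\omega$, the associated word is $\omega_L = \omega(a_1)\omega(a_2)\cdots\omega(a_n)$, with $\operatorname{Asc}(\omega_L)=\{j : \omega(a_j)<\omega(a_{j+1})\}$ and $\operatorname{Des}(\omega_L)=\{j : \omega(a_j)>\omega(a_{j+1})\}$. A map $\varphi: L \to [x]$ is of type $\omega_L$ if $\varphi(a_i)\le\varphi(a_{i+1})$ for all $i\in\operatorname{Asc}(\omega_L)$ and $\varphi(a_i)<\varphi(a_{i+1})$ for all $i\in\operatorname{Des}(\omega_L)$. $\Omega_{\omega_L}(x,y)$ is the number of maps $\varphi : L \to [x]$ of type $\omega_L$ with $\varphi(c)\ge y$ for all $c\in C$ (equivalently, for the minimal celeste element of $L$, if there is one); $\Omega^{\circ}_{\omega_L}(x,y)$ is the number of maps $\varphi : L \to [x]$ of type $\omega_L$ with $\varphi(c) > y$ for all $c \in C$. $\Omega_{\tau_L}$ is defined in the same way with $\tau$ in place of $\omega$. *)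

(* Defs.v *)
From mathcomp Require Import all_boot all_order.

Set Implicit Arguments.
Unset Strict Implicit.
Unset Printing Implicit Defensive.

(* A bicolored poset is given by a finite poset P and its set C : {set P} of
   celeste elements; the silver elements are those of ~: C.

   The interval [x] = {1, ..., x} is encoded by 'I_x, the ordinal i standing
   for the integer i.+1.  The shift only matters when a value is compared with
   y, which is why (phi c).+1 occurs below. *)

Definition order_preserving_map (d : Order.disp_t) (P : finPOrderType d)
    (C : {set P}) (x y : nat) (phi : {ffun P -> 'I_x}) : bool :=
  [forall a : P, forall b : P, (a <= b)%O ==> (phi a <= phi b)]
  && [forall c in C, (phi c).+1 >= y].

Definition strict_order_preserving_map (d : Order.disp_t)
    (P : finPOrderType d) (C : {set P}) (x y : nat)
    (phi : {ffun P -> 'I_x}) : bool :=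
  [forall a : P, forall b : P, (a < b)%O ==> (phi a < phi b)]
  && [forall c in C, (phi c).+1 > y].

Definition Omega (d : Order.disp_t) (P : finPOrderType d) (C : {set P})
    (x y : nat) : nat :=
  #|[set phi : {ffun P -> 'I_x} | order_preserving_map C y phi]|.

Definition Omega_strict (d : Order.disp_t) (P : finPOrderType d)
    (C : {set P}) (x y : nat) : nat :=
  #|[set phi : {ffun P -> 'I_x} | strict_order_preserving_map C y phi]|.

Definition labeling (d : Order.disp_t) (P : finPOrderType d) (n : nat)
    (w : P -> 'I_n) : Prop := bijective w.

Definition natural (d : Order.disp_t) (P : finPOrderType d) (n : nat)
    (w : P -> 'I_n) : Prop := forall a b : P, (a < b)%O -> w a < w b.

Definition reverse_natural (d : Order.disp_t) (P : finPOrderType d) (n : nat)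
    (w : P -> 'I_n) : Prop := forall a b : P, (a < b)%O -> w a > w b.

(* The chain a_1 < ... < a_n is encoded by the tuple of its elements in
   increasing order, so a is below b in L iff index a L <= index b L. *)
Definition linear_extension (d : Order.disp_t) (P : finPOrderType d) (n : nat)
    (L : n.-tuple P) : bool :=
  perm_eq L (enum P)
  && [forall a : P, forall b : P, (a <= b)%O ==> (index a L <= index b L)].

Definition label_word (d : Order.disp_t) (P : finPOrderType d) (n : nat)
    (w : P -> 'I_n) (L : n.-tuple P) : seq nat := [seq val (w a) | a <- L].

(* Positions in a word are counted from 0. *)
Definition Asc (u : seq nat) : pred nat :=
  [pred j | (j.+1 < size u) && (nth 0 u j < nth 0 u j.+1)].

Definition Des (u : seq nat) : pred nat :=
  [pred j | (j.+1 < size u) && (nth 0 u j > nth 0 u j.+1)].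

(* v lists the values of phi along L, so nth 0 v i stands for phi(a_(i+1)). *)
Definition of_type (d : Order.disp_t) (P : finPOrderType d) (n x : nat)
    (w : P -> 'I_n) (L : n.-tuple P) (phi : {ffun P -> 'I_x}) : bool :=
  let v := [seq val (phi a) | a <- L] in
  [forall i : 'I_n, (val i \in Asc (label_word w L)) ==>
                    (nth 0 v i <= nth 0 v i.+1)]
  && [forall i : 'I_n, (val i \in Des (label_word w L)) ==>
                       (nth 0 v i < nth 0 v i.+1)].

Definition Omega_word (d : Order.disp_t) (P : finPOrderType d) (C : {set P})
    (n : nat) (w : P -> 'I_n) (L : n.-tuple P) (x y : nat) : nat :=
  #|[set phi : {ffun P -> 'I_x} |
      of_type w L phi && [forall c in C, (phi c).+1 >= y]]|.

Definition Omega_word_strict (d : Order.disp_t) (P : finPOrderType d)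
    (C : {set P}) (n : nat) (w : P -> 'I_n) (L : n.-tuple P)
    (x y : nat) : nat :=
  #|[set phi : {ffun P -> 'I_x} |
      of_type w L phi && [forall c in C, (phi c).+1 > y]]|.

(* Main.v *)
(* Fix an injective labeling w and a map phi.  A listing L of P is such that
   phi is of type w_L exactly when L is sorted for the total order on P that
   compares values of phi and breaks ties by w; so there is exactly one such L.
   When w is natural (resp. reverse natural), this L is a linear extension of P
   exactly when phi is weakly (resp. strictly) order preserving.  Summing over
   L thus counts every order preserving map once. *)

Require Import Defs.
From mathcomp Require Import all_boot all_order.
From mathcomp Require Import zify.

Set Implicit Arguments.
Unset Strict Implicit.
Unset Printing Implicit Defensive.

Import Order.POrderTheory.

Definition lex_le (T : Type) (n x : nat) (w : T -> 'I_n) (phi : T -> 'I_x) :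
    rel T :=
  fun a b => (phi a < phi b) || ((phi a == phi b :> nat) && (w a <= w b)).

Lemma lex_le_refl (T : Type) (n x : nat) (w : T -> 'I_n) (phi : T -> 'I_x) :
  reflexive (lex_le w phi).
Proof. by move=> a; rewrite /lex_le eqxx leqnn orbT. Qed.

Lemma lex_le_trans (T : Type) (n x : nat) (w : T -> 'I_n) (phi : T -> 'I_x) :
  transitive (lex_le w phi).
Proof. by move=> b a c; rewrite /lex_le; lia. Qed.

Lemma lex_le_total (T : Type) (n x : nat) (w : T -> 'I_n) (phi : T -> 'I_x) :
  total (lex_le w phi).
Proof. by move=> a b; rewrite /lex_le; lia. Qed.

Lemma lex_le_anti (T : Type) (n x : nat) (w : T -> 'I_n) (phi : T -> 'I_x) :
  injective w -> antisymmetric (lex_le w phi).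
Proof.
move=> w_inj a b; rewrite /lex_le => ab.
by apply/w_inj/val_inj => /=; lia.
Qed.

(** Adjacent labels differ, as [w] is injective and [L] has no repetition, so every position is an
    ascent or a descent. [lex_le] between neighbours means a weak inequality of values at an ascent
    and a strict one at a descent. *)
Lemma of_type_sorted (d : Order.disp_t) (P : finPOrderType d) (n x : nat)
    (w : P -> 'I_n) (L : n.-tuple P) (phi : {ffun P -> 'I_x}) :
  injective w -> uniq L -> of_type w L phi = sorted (lex_le w phi) L.
Proof.
move=> w_inj uL.
have nthE (T : Type) (f : P -> T) z0 a0 i : i < n ->
    nth z0 [seq f a | a <- L] i = f (nth a0 L i).
  by move=> i_n; rewrite (nth_map a0) ?size_tuple.
have w_neq a0 i : i.+1 < n -> w (nth a0 L i) != w (nth a0 L i.+1) :> nat.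
  move=> i_n; apply/negP => /eqP/val_inj/w_inj/eqP.
  by rewrite nth_uniq ?size_tuple //; lia.
apply/andP/idP => [[/forallP asc /forallP des]|].
(* The case split only supplies a default element [a0] for [nth]. *)
- case E: (tval L) => [//|a0 s]; rewrite -{s}E.
  apply/(sortedP a0) => i; rewrite size_tuple => i_n.
  have i_n' := ltnW i_n.
  have := asc (Ordinal i_n'); have := des (Ordinal i_n').
  have := w_neq a0 i i_n.
  rewrite /Asc /Des /label_word !inE /= size_map size_tuple i_n.
  by rewrite !(nthE _ _ _ a0) // /lex_le; lia.
- move=> sL; split; apply/forallP => i; apply/implyP;
    rewrite /Asc /Des /label_word inE /= size_map size_tuple;
    move=> /andP[i_n];
    have a0 := tnth L i;
    have := w_neq a0 i i_n;
    have /(sortedP a0) /(_ i) := sL;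
    rewrite size_tuple => /(_ i_n);
    rewrite !(nthE _ _ _ a0) // /lex_le; lia.
Qed.

(** Along a sorted listing, comparing indices is the same as comparing by [lex_le]. *)
Lemma sorted_linear_extension (d : Order.disp_t) (P : finPOrderType d)
    (n x : nat) (w : P -> 'I_n) (L : n.-tuple P) (phi : {ffun P -> 'I_x}) :
  injective w -> perm_eq L (enum P) -> sorted (lex_le w phi) L ->
  linear_extension L =
    [forall a : P, forall b : P, (a <= b)%O ==> lex_le w phi a b].
Proof.
move=> w_inj pL sL; rewrite /linear_extension pL /=.
have memL a : a \in (L : seq P) by rewrite (perm_mem pL) mem_enum.
have indexE a b : (index a L <= index b L) = lex_le w phi a b.
  apply/idP/idP.
    exact: (sorted_leq_index (@lex_le_trans _ _ _ w phi)
                             (@lex_le_refl _ _ _ w phi) sL).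
  move=> ab; rewrite leqNgt; apply/negP => ba.
  (* If [b] came strictly before [a], sortedness and antisymmetry would force [a = b]. *)
  have /(lex_le_anti w_inj) E : lex_le w phi a b && lex_le w phi b a.
    rewrite ab; apply: (sorted_ltn_index (@lex_le_trans _ _ _ w phi) sL) => //.
  by rewrite E ltnn in ba.
by apply: eq_forallb => a; apply: eq_forallb => b; rewrite indexE.
Qed.

(** Double counting of pairs [(L, phi)]. [Q] stands for either order condition and [D] for the bound
    on celeste elements, which is carried along unchanged. *)
Lemma card_sum_of_type (d : Order.disp_t) (P : finPOrderType d) (n x : nat)
    (w : P -> 'I_n) (Q D : pred {ffun P -> 'I_x}) :
  #|P| = n -> injective w ->
  (forall phi : {ffun P -> 'I_x}, Q phi =
    [forall a : P, forall b : P, (a <= b)%O ==> lex_le w phi a b]) ->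
  #|[set phi | Q phi && D phi]| =
    \sum_(L : n.-tuple P | linear_extension L)
       #|[set phi | of_type w L phi && D phi]|.
Proof.
move=> cardP w_inj QE.
have card_setE (R : pred {ffun P -> 'I_x}) : #|[set phi | R phi]| = \sum_phi R phi.
  by rewrite -sum1dep_card big_mkcond.
under eq_bigr do rewrite card_setE.
rewrite card_setE exchange_big /=; apply: eq_bigr => phi _.
have szL : size (sort (lex_le w phi) (enum P)) == n.
  by rewrite size_sort -cardE cardP.
(* For a fixed [phi], the sorted listing is the only [L] that can contribute. *)
pose L0 := Tuple szL.
have pL0 : perm_eq L0 (enum P) by rewrite /= perm_sort.
have sL0 : sorted (lex_le w phi) L0 by exact/sort_sorted/lex_le_total.
have typeE (L : n.-tuple P) : linear_extension L ->
    of_type w L phi = (L == L0).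
  case/andP=> pL _; rewrite of_type_sorted //; last first.
    by rewrite (perm_uniq pL) enum_uniq.
  apply/idP/eqP => [sL|-> //]; apply/val_inj.
  apply: (sorted_eq (@lex_le_trans _ _ _ w phi) (lex_le_anti w_inj)) => //.
  by rewrite (permPl pL) perm_sym.
rewrite QE -(sorted_linear_extension w_inj pL0 sL0).
under eq_bigr => L HL do rewrite typeE //.
(* If [L0] is not a linear extension, both sides vanish; otherwise both equal [D phi]. *)
rewrite big_mkcond (bigD1 L0) //= eqxx big1 ?addn0; first by case: ifP.
by move=> L /negPf ->; case: ifP.
Qed.

(** For [a < b] the labels decrease, so a tie in [phi] violates [lex_le]. *)
Lemma strict_order_preserving_lex (d : Order.disp_t) (P : finPOrderType d)
    (n x : nat) (w : P -> 'I_n) (phi : {ffun P -> 'I_x}) :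
  reverse_natural w ->
  [forall a : P, forall b : P, (a < b)%O ==> (phi a < phi b)] =
  [forall a : P, forall b : P, (a <= b)%O ==> lex_le w phi a b].
Proof.
move=> rw; apply: eq_forallb => a; apply: eq_forallb => b.
rewrite le_eqVlt; case: eqVneq => [<-|_] /=; first by rewrite ltxx lex_le_refl.
by case: (boolP (a < b)%O) => //= /rw; rewrite /lex_le; lia.
Qed.

(** For [a < b] the labels increase, so a tie in [phi] satisfies [lex_le]. *)
Lemma order_preserving_lex (d : Order.disp_t) (P : finPOrderType d)
    (n x : nat) (w : P -> 'I_n) (phi : {ffun P -> 'I_x}) :
  natural w ->
  [forall a : P, forall b : P, (a <= b)%O ==> (phi a <= phi b)] =
  [forall a : P, forall b : P, (a <= b)%O ==> lex_le w phi a b].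
Proof.
move=> nw; apply: eq_forallb => a; apply: eq_forallb => b.
rewrite le_eqVlt; case: eqVneq => [<-|_] /=; first by rewrite leqnn lex_le_refl.
by case: (boolP (a < b)%O) => //= /nw; rewrite /lex_le; lia.
Qed.

Theorem theorem7 (d : Order.disp_t) (P : finPOrderType d) (C : {set P})
    (n : nat) (hn : #|P| = n)
    (omega : P -> 'I_n) (homega : labeling omega)
    (romega : reverse_natural omega)
    (tau : P -> 'I_n) (htau : labeling tau) (ntau : natural tau)
    (x y : nat) :
  Omega_strict C x y =
    \sum_(L : n.-tuple P | linear_extension L) Omega_word_strict C omega L x y
  /\
  Omega C x y =
    \sum_(L : n.-tuple P | linear_extension L) Omega_word C tau L x y.
Proof.
split.
- by apply: (card_sum_of_type _ hn (bij_inj homega)) => phi;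
    exact: strict_order_preserving_lex.
- by apply: (card_sum_of_type _ hn (bij_inj htau)) => phi;
    exact: order_preserving_lex.
Qed.
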